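(* Bounded packing is a quasi-isometry invariant of group pairs: if $(G,\mathcal{P})$ and $(H,\mathcal{Q})$ are quasi-isometric group pairs, then $(G,\mathcal{P})$ has bounded packing if and only if $(H,\mathcal{Q})$ has bounded packing.
   Context: A group pair $(G,\mathcal{P})$ is a finitely generated group $G$ together with a finite collection $\mathcal{P}$ of infinite subgroups of $G$. $G$ carries a fixed word metric $\mathrm{dist}_G$ with respect to a finite generating set; distance between subsets means infimum distance, and $\mathrm{hdist}_G$ is the Hausdorff distance. $G/\mathcal{P}$ is the set of all left cosets $gP$, $g\in G$, $P\in\mathcal{P}$. $(G,\mathcal{P})$ and $(H,\mathcal{Q})$ are quasi-isometric if there are a quasi-isometry $q\colon G\to H$ and $M>0$ such that for every $A\in G/\mathcal{P}$ there is $B\in H/\mathcal{Q}$ with $\mathrm{hdist}_H(q(A),B)<M$, and for every $B\in H/\mathcal{Q}$ there is $A\in G/\mathcal{P}$ with $\mathrm{hdist}_H(q(A),B)<M$. $(G,\mathcal{P})$ has bounded packing if for each constant $D$ there is a number $N$ such that for any collection of $N$ distinct cosets $g_1P_1,\dots,g_NP_N$ in $G/\mathcal{P}$, at least two are separated by a distance of at least $D$ in $(G,\mathrm{dist}_G)$. *)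

(* Defs.v *)
From HB Require Import structures.
From mathcomp Require Import all_boot all_order all_algebra.
From mathcomp Require Import boolp classical_sets functions cardinality reals ereal.
Set Implicit Arguments.
Unset Strict Implicit.
Unset Printing Implicit Defensive.
Import Order.TTheory GRing.Theory Num.Theory.
Local Open Scope classical_set_scope.
Local Open Scope ring_scope.

Section WordMetric.
Variable G : groupType.
Implicit Types (S : set G) (g x y : G).

Definition word_for S g (w : seq G) : Prop :=
  (forall s, s \in w -> S s \/ S (s^-1)%g) /\ (\prod_(s <- w) s)%g = g.

Definition generates S : Prop := forall g, exists w, word_for S g w.

Definition has_word_of_size S g : pred nat :=
  fun n => `[< exists2 w, word_for S g w & size w = n >].

Lemma generates_has_word S : generates S ->
  forall g, exists n, has_word_of_size S g n.
Proof.
by move=> genS g; have [w wg] := genS g; exists (size w); apply/asboolP; exists w.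
Qed.

Definition word_length S (genS : generates S) g : nat :=
  ex_minn (generates_has_word genS g).

(* left-invariant, since the cosets considered are left cosets *)
Definition word_dist (R : realType) S (genS : generates S) x y : R :=
  (word_length genS (x^-1 * y)%g)%:R.

End WordMetric.

(* Besides the group and the collection of subgroups, a pair carries the finite
   generating set that fixes the word metric. The collection may be empty. *)
Record group_pair (G : groupType) := GroupPair {
  gens : set G;
  gens_finite : finite_set gens;
  gens_generate : generates gens;
  periph : set (set G);
  periph_finite : finite_set periph;
  periph_subgroup : forall P, periph P -> group_closed (mem P);
  periph_infinite : forall P, periph P -> infinite_set P
}.

Definition pair_dist (R : realType) (G : groupType) (P : group_pair G) :
  G -> G -> R := word_dist R (gens_generate P).

Definition left_coset (G : groupType) (g : G) (A : set G) : set G :=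
  [set (g * x)%g | x in A].

(* Cosets are compared as subsets of G. *)
Definition cosets (G : groupType) (P : group_pair G) : set (set G) :=
  [set left_coset g A | g in [set: G] & A in periph P].

Section Distances.
Variables (R : realType) (T : Type) (d : T -> T -> R).

Definition set_dist (A B : set T) : \bar R :=
  ereal_inf [set (d x y)%:E | x in A & y in B].

Definition hdist (A B : set T) : \bar R :=
  Order.max (ereal_sup [set set_dist [set a] B | a in A])
            (ereal_sup [set set_dist A [set b] | b in B]).

End Distances.

Definition quasi_isometry (R : realType) (T U : Type)
    (dT : T -> T -> R) (dU : U -> U -> R) (q : T -> U) : Prop :=
  exists L C : R,
    [/\ 1 <= L, 0 <= C,
        forall x y, L^-1 * dT x y - C <= dU (q x) (q y) <= L * dT x y + C
      & forall u, exists x, dU u (q x) <= C].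

Definition quasi_isometric_pairs (R : realType) (G H : groupType)
    (P : group_pair G) (Q : group_pair H) : Prop :=
  exists (q : G -> H) (M : R),
    [/\ quasi_isometry (pair_dist R P) (pair_dist R Q) q,
        0 < M,
        forall A, cosets P A -> exists2 B, cosets Q B &
          (hdist (pair_dist R Q) (q @` A) B < M%:E)%E
      & forall B, cosets Q B -> exists2 A, cosets P A &
          (hdist (pair_dist R Q) (q @` A) B < M%:E)%E].

Definition bounded_packing (R : realType) (G : groupType)
    (P : group_pair G) : Prop :=
  forall D : R, exists N : nat, forall A : 'I_N -> set G,
    injective A -> (forall i, cosets P (A i)) ->
    exists i j, i != j /\
      (D%:E <= set_dist (pair_dist R P) (A i) (A j))%E.

(* Main.v *)
(* Left cosets of peripheral subgroups that meet a fixed ball are uniformly few,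
   since each is determined by a subgroup in the finite collection and a point of
   the ball. The quasi-isometry gives a correspondence between cosets which
   preserves "being at bounded distance" in both directions; it need not be
   injective, but all cosets corresponding to a given one meet a ball of
   uniform radius. Hence a large family of pairwise close cosets on one side
   yields, by the pigeonhole principle, a large family of pairwise close cosets
   on the other. *)
Require Import Defs.
From mathcomp Require Import all_boot reals.
From mathcomp Require Import all_order all_algebra.
From mathcomp Require Import boolp classical_sets cardinality ereal.
From mathcomp Require Import lra.
Import Order.TTheory GRing.Theory Num.Theory.
Local Open Scope classical_set_scope.
Local Open Scope ring_scope.

(** Fibres of size at most [k] force at least [m] distinct values; [g] picks one preimage for each
    of [m] of them. *)
Lemma pigeonhole_injective_subfamily (T : eqType) (n m k : nat) (f : 'I_n -> T) :
  (forall t, #|[set i | f i == t]%SET| <= k)%N -> (k * m <= n)%N ->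
  (0 < k)%N -> exists g : 'I_m -> 'I_n, injective (f \o g).
Proof.
move=> fiber kmn k_gt0.
have size_img : (m <= size (undup (codom f)))%N.
  rewrite -(leq_pmul2l k_gt0) (leq_trans kmn)//.
  rewrite -[X in (X <= _)%N]card_ord -(size_codom f) -sum1_size.
  (* This writes [n] as the sum, over the distinct values of [f], of their multiplicities. *)
  rewrite -big_undup_iterop_count.
  rewrite (@leq_trans (\sum_(t <- undup (codom f)) k))%N//; last first.
    by rewrite big_const_seq count_predT iter_addn addn0.
  apply: leq_sum => t _.
  rewrite Monoid.iteropE iter_addn mul1n addn0.
  rewrite (leq_trans _ (fiber t))// cardE /codom /image_mem count_map.
  rewrite -size_filter -filter_predI; apply/eq_leq.
  rewrite /enum_mem; congr size.
  by apply: eq_filter => i; rewrite /= !inE andbT.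
have idx (j : 'I_m) : exists i, index (f i) (undup (codom f)) = j.
  have : (j < size (undup (codom f)))%N by rewrite (leq_trans _ size_img).
  case imgE : (undup (codom f)) => [//|x0 s] js.
  have : nth x0 (undup (codom f)) j \in codom f.
    by rewrite -mem_undup mem_nth// imgE.
  case/codomP => i fi; exists i.
  by rewrite -fi imgE index_uniq// -imgE undup_uniq.
have [g gE] := choice idx.
exists g => i j /= fij; apply: val_inj.
by rewrite /= -gE fij gE.
Qed.

Section WordMetric.
Context {G : groupType} {S : set G} (genS : generates S).

Lemma word_length_word g :
  exists2 w, word_for S g w & size w = word_length genS g.
Proof. by rewrite /word_length; case: ex_minnP => n /asboolP. Qed.

Lemma word_length_le {g w} : word_for S g w -> (word_length genS g <= size w)%N.
Proof.
move=> gw; rewrite /word_length; case: ex_minnP => n _; apply.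
by apply/asboolP; exists w.
Qed.

Lemma word_lengthM x y :
  (word_length genS (x * y)%g <= word_length genS x + word_length genS y)%N.
Proof.
have [v [vS vx] <-] := word_length_word x; have [w [wS wy] <-] := word_length_word y.
rewrite -size_cat; apply: word_length_le; split; last by rewrite big_cat vx wy.
by move=> s; rewrite mem_cat => /orP[/vS|/wS].
Qed.

Lemma word_lengthV_le x : (word_length genS x^-1%g <= word_length genS x)%N.
Proof.
have [w [wS wx] <-] := word_length_word x.
rewrite -size_rev -(size_map (fun s => s^-1)%g); apply: word_length_le; split; last first.
  by rewrite big_map prodgV revK wx.
move=> _ /mapP[s + ->]; rewrite mem_rev invgK => /wS [|]; tauto.
Qed.

Lemma word_lengthV x : word_length genS x^-1%g = word_length genS x.
Proof.
by apply/eqP; rewrite eqn_leq word_lengthV_le -{1}(invgK x) word_lengthV_le.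
Qed.

Lemma finite_words_of_size (n : nat) : finite_set S ->
  finite_set [set g | exists2 w, word_for S g w & size w = n].
Proof.
move=> finS; have finT : finite_set (S `|` [set s^-1%g | s in S]).
  by rewrite finite_setU; split=> //; apply: finite_image.
elim: n => [|n IHn].
  apply: (@sub_finite_set _ _ [set 1%g]); last exact: finite_set1.
  by move=> g [w [_ <-] /size0nil ->] /=; rewrite big_nil.
apply: sub_finite_set (finite_image2 (fun s g => s * g)%g finT IHn).
move=> g [[//|s w] [wS <-] [sz_w]]; rewrite big_cons.
exists s; last first.
  exists (\prod_(t <- w) t)%g => //; exists w => //; split=> // t tw.
  by apply: wS; rewrite inE tw orbT.
have [|sS|sS] := wS s; [by rewrite mem_head|by left|].
by right; exists s^-1%g => //; rewrite invgK.
Qed.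

Lemma finite_word_ball (n : nat) : finite_set S ->
  finite_set [set g | (word_length genS g <= n)%N].
Proof.
move=> finS; apply: (@sub_finite_set _ _
  (\bigcup_(k in `I_n.+1) [set g | exists2 w, word_for S g w & size w = k])).
  move=> g /= gn; exists (word_length genS g) => //; exact: word_length_word.
by apply: bigcup_finite => [|k _]; [exact: finite_II|exact: finite_words_of_size].
Qed.

End WordMetric.

Section GroupPair.
Context {R : realType} {G : groupType} (P : group_pair G).

Lemma pair_dist_triangle y x z :
  pair_dist R P x z <= pair_dist R P x y + pair_dist R P y z.
Proof.
rewrite -natrD ler_nat; apply: leq_trans (word_lengthM _ _ _).
by rewrite mulgA mulgK.
Qed.

Lemma pair_distC x y : pair_dist R P x y = pair_dist R P y x.
Proof. by rewrite /pair_dist /word_dist -word_lengthV invgM invgK. Qed.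

Lemma coset_nonempty {A} : cosets P A -> A !=set0.
Proof.
move=> [g _ [B PB <-]]; have [B1 _] := periph_subgroup PB.
by exists (g * 1)%g; exists 1%g => //; move: B1; rewrite in_setE.
Qed.

(** With [b] in the subgroup [B], [gB = gbB], so any point of a coset can serve as its
    representative. This makes it possible to count cosets by their points. *)
Lemma coset_of_mem {A a} : cosets P A -> A a ->
  exists2 B, periph P B & A = left_coset a B.
Proof.
move=> [g _ [B PB <-]] [b Bb <-]; exists B => //.
have closedB := periph_subgroup PB; have bB : b \in mem B by rewrite in_setE.
have mulB x y : x \in mem B -> B y -> B (x * y)%g.
  move=> xB By; have yB : y \in mem B by rewrite in_setE.
  by have := @group_closedM _ _ closedB x y xB yB; rewrite in_setE.
apply/seteqP; split=> _ [c Bc <-].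
  exists (b^-1 * c)%g; last by rewrite mulgA mulgK.
  by apply: mulB => //; exact: (@group_closedV _ _ closedB b bB).
by exists (b * c)%g; [exact: mulB|rewrite mulgA].
Qed.

(* The bound does not depend on the centre [x], by left invariance. *)
Lemma cosets_meeting_ball (r : R) : exists K : nat, forall x, exists L : seq (set G),
  size L = K /\ forall A a, cosets P A -> A a -> pair_dist R P x a <= r -> A \in L.
Proof.
have [n rn] : exists n : nat, r <= n%:R.
  have [r_ge0|r_lt0] := leP 0 r; last by exists 0; apply: ltW.
  by exists (Num.bound r); exact/ltW/archi_boundP.
have /finite_seqP[b bE] := finite_word_ball (gens_generate P) n (gens_finite P).
have /finite_seqP[p pE] := periph_finite P.
(* Here [b] lists the ball around the identity and [p] the peripheral subgroups; translating [b] by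
   [x] changes no length. The list may repeat cosets, so [K] is only an upper bound. *)
exists (size b * size p)%N => x.
exists [seq left_coset (x * g)%g B | g <- b, B <- p].
split=> [|A a PA Aa /le_trans/(_ rn)]; first exact: size_allpairs.
rewrite ler_nat => xa; have [B PB ->] := coset_of_mem PA Aa.
apply/allpairsP; exists ((x^-1 * a)%g, B); split=> /=.
- by have : [set` b] (x^-1 * a)%g by rewrite -bE.
- by have : [set` p] B by rewrite -pE.
- by rewrite mulgA mulgV mul1g.
Qed.

End GroupPair.

Section Distances.
Context {R : realType} {T : Type} {d : T -> T -> R}.
Local Open Scope ereal_scope.

(** An infimum need not be attained, but one strictly below [D] has a witness below [D]; hence
    strict bounds are used throughout. *)
Lemma set_dist_lt {A B : set T} {D : R} : set_dist d A B < D%:E ->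
  exists a b, [/\ A a, B b & (d a b < D)%R].
Proof.
by move=> /ereal_inf_lt[_ [a Aa [b Bb <-]]]; rewrite lte_fin => dab; exists a, b.
Qed.

Lemma lt_set_dist {A B : set T} {D : R} a b : A a -> B b -> (d a b < D)%R ->
  set_dist d A B < D%:E.
Proof.
move=> Aa Bb dab; apply: (@le_lt_trans _ _ (d a b)%:E); last by rewrite lte_fin.
by apply: ge_ereal_inf; exists (d a b)%:E => //; exists a => //; exists b.
Qed.

Lemma hdist_ltl {A B : set T} {M : R} {a} : hdist d A B < M%:E -> A a ->
  exists2 b, B b & (d a b < M)%R.
Proof.
rewrite /hdist gt_max => /andP[AB _] Aa.
have : set_dist d [set a] B < M%:E.
  apply: le_lt_trans AB; apply: le_ereal_sup_tmp.
  by exists (set_dist d [set a] B) => //; exists a.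
by move=> /set_dist_lt[_ [b [-> Bb dab]]]; exists b.
Qed.

Lemma hdist_ltr {A B : set T} {M : R} {b} : hdist d A B < M%:E -> B b ->
  exists2 a, A a & (d a b < M)%R.
Proof.
rewrite /hdist gt_max => /andP[_ AB] Bb.
have : set_dist d A [set b] < M%:E.
  apply: le_lt_trans AB; apply: le_ereal_sup_tmp.
  by exists (set_dist d A [set b]) => //; exists b.
by move=> /set_dist_lt[a [_ [Aa -> dab]]]; exists a.
Qed.

End Distances.

(** Stating the correspondence as a relation [E] lets one argument serve both directions, with no
    quasi-inverse of the quasi-isometry. The last condition on [E] bounds its fibres. *)
Lemma bounded_packing_transfer (R : realType) (G H : groupType)
    (P : group_pair G) (Q : group_pair H) (E : set G -> set H -> Prop) (r : R) :
  (forall A, cosets P A -> exists2 B, cosets Q B & E A B) ->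
  (forall D : R, exists D' : R, forall A A' B B', E A B -> E A' B' ->
    (set_dist (pair_dist R P) A A' < D%:E)%E ->
    (set_dist (pair_dist R Q) B B' < D'%:E)%E) ->
  (forall B, cosets Q B -> exists x, forall A, cosets P A -> E A B ->
    exists2 a, A a & pair_dist R P x a <= r) ->
  bounded_packing R Q -> bounded_packing R P.
Proof.
move=> ex_E close_E ball_E packQ D.
have [D' closeD] := close_E D; have [N packN] := packQ D'.
have [K ballK] := cosets_meeting_ball P r.
(* At most [K] of the cosets share a partner; [K.+1] keeps the bound positive when [K] is 0, as for
   an empty peripheral collection. *)
exists (K.+1 * N)%N => A injA PA.
have ex_QE i : exists C, cosets Q C /\ E (A i) C.
  by have [C QC EC] := ex_E _ (PA i); exists C.
have [B QEB] := choice ex_QE.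
have [g injBg] : exists g : 'I_N -> 'I_(K.+1 * N), injective (B \o g).
  apply: (@pigeonhole_injective_subfamily _ _ _ K.+1) => // C.
  have [QC|nQC] := pselect (cosets Q C); last first.
    rewrite eq_card0// => i; rewrite !inE; apply/negbTE/eqP => BiC.
    by apply: nQC; rewrite -BiC; case: (QEB i).
  have [x xE] := ball_E C QC; have [L [LK LE]] := ballK x.
  rewrite ltnW// ltnS -[X in (_ <= X)%N]LK cardE -(size_map A).
  (* Injectivity of [A] makes the cosets indexed by a fibre distinct, and all of them lie in [L]. *)
  apply: uniq_leq_size.
    by rewrite map_inj_uniq ?enum_uniq.
  move=> _ /mapP[i + ->]; rewrite mem_enum inE => /eqP BiC.
  have EiC : E (A i) C by rewrite -BiC; case: (QEB i).
  have [a Aa xa] := xE _ (PA i) EiC.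
  exact: LE (PA i) Aa xa.
have [i [j [ij far]]] := packN _ injBg (fun i => (QEB (g i)).1).
exists (g i), (g j); split.
  by apply: contra_neq ij => gij; apply: injBg; rewrite /= gij.
rewrite leNgt; apply/negP.
move=> /(closeD _ _ _ _ (QEB (g i)).2 (QEB (g j)).2).
by rewrite ltNge far.
Qed.

Theorem theorem3p6 (R : realType) (G H : groupType)
    (P : group_pair G) (Q : group_pair H) :
  quasi_isometric_pairs R P Q ->
  (bounded_packing R P <-> bounded_packing R Q).
Proof.
move=> [q [M [[L [C [L1 C0 qi _]]] M0 PQ QP]]].
have L0 : 0 < L by lra.
have qi_lower x y : pair_dist R P x y <= L * (pair_dist R Q (q x) (q y) + C).
  by have /andP[+ _] := qi x y; rewrite lerBlDr mulrC ler_pdivrMr// mulrC.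
have qi_upper x y : pair_dist R Q (q x) (q y) <= L * pair_dist R P x y + C.
  by have /andP[] := qi x y.
split.
- apply: (@bounded_packing_transfer _ _ _ _ _
    (fun B A => cosets P A /\ hdist (pair_dist R Q) (q @` A) B < M%:E)%E M).
  + by move=> B /QP[A PA AB]; exists A.
  (* Close points [b], [b'] are each within [M] of image points, which are then less than
     [D + 2 * M] apart; [qi_lower] pulls this back to [G]. *)
  + move=> D; exists (L * (D + 2 * M + C)) => B B' A A' [_ AB] [_ AB'].
    move=> /set_dist_lt[b [b' [Bb Bb' bb']]].
    have [_ [a Aa <-] ab] := hdist_ltr AB Bb.
    have [_ [a' Aa' <-] ab'] := hdist_ltr AB' Bb'.
    apply: (lt_set_dist a a') => //; apply: le_lt_trans (qi_lower _ _) _.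
    rewrite ltr_pM2l//.
    have := pair_dist_triangle Q b (q a) (q a') (R := R).
    have := pair_dist_triangle Q b' b (q a') (R := R).
    by rewrite (pair_distC Q b'); lra.
  + move=> A PA; have [a Aa] := coset_nonempty P PA.
    (* Every coset matched with [A] comes within [M] of the image of one chosen point of [A]. *)
    exists (q a) => B _ [_ AB].
    have [|b Bb ab] := hdist_ltl (a := q a) AB; first by exists a.
    by exists b => //; exact: ltW.
- apply: (@bounded_packing_transfer _ _ _ _ _
    (fun A B => cosets Q B /\ hdist (pair_dist R Q) (q @` A) B < M%:E)%E
    (L * (2 * M + C))).
  + by move=> A /PQ[B QB AB]; exists B.
  (* [qi_upper] contributes [L * D + C], and moving from the two image points to [b] and [b'] costs
     [M] each. *)
  + move=> D; exists (L * D + C + 2 * M) => A A' B B' [_ AB] [_ AB'].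
    move=> /set_dist_lt[a [a' [Aa Aa' aa']]].
    have [|b Bb ab] := hdist_ltl (a := q a) AB; first by exists a.
    have [|b' Bb' ab'] := hdist_ltl (a := q a') AB'; first by exists a'.
    apply: (lt_set_dist b b') => //.
    have := pair_dist_triangle Q (q a) b b' (R := R).
    have := pair_dist_triangle Q (q a') (q a) b' (R := R).
    have := qi_upper a a'.
    have : L * pair_dist R P a a' < L * D by rewrite ltr_pM2l.
    by rewrite (pair_distC Q b (q a)); lra.
  (* The centre must lie in [G], so it is a point [x] of some matched coset with [q x] within [M] of
     a fixed [b]. Any other matched coset has a point [a] with [q a] within [M] of [b], so [q x] and
     [q a] are less than [2 * M] apart, which gives the radius [L * (2 * M + C)]. *)
  + move=> B QB; have [b Bb] := coset_nonempty Q QB.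
    have [A0 PA0 A0B] := QP B QB.
    have [_ [x A0x <-] xb] := hdist_ltr A0B Bb.
    exists x => A _ [_ AB].
    have [_ [a Aa <-] ab] := hdist_ltr AB Bb.
    exists a => //; apply: le_trans (qi_lower _ _) _.
    rewrite ler_pM2l//.
    have := pair_dist_triangle Q b (q x) (q a) (R := R).
    by rewrite (pair_distC Q b); lra.
Qed.
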